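(* Any streaming certification scheme for $\mathrm{Diameter}_{\geq 8}$ whose verifier uses $m$ bits of memory and whose certificates have $c$ bits satisfies $c+m=\Omega(n)$ on $n$-node graphs.
   Context: $\mathrm{Diameter}_{\geq 8}$ is the decision problem (with fixed threshold $8$) taking as input a graph $G$ and asking whether the diameter of $G$ (the maximum over pairs of vertices of their shortest-path distance) is at least $8$. The $n$-node input graph on $[n]$ is given as a stream of edges in an arbitrary, possibly adversarial, order. A streaming certification scheme for a decision problem $P$ consists of a prover (a computationally unlimited function producing a certificate in $\{0,1\}^*$ depending only on the input graph, not on the edge order) and a verifier (a deterministic streaming algorithm with read-only access to the certificate that processes the stream and outputs accept or reject). Completeness: if $G$ satisfies $P$, some certificate makes the verifier accept for every edge order. Soundness: if $G$ does not satisfy $P$, the verifier rejects for every certificate and every edge order. $c$ is the certificate length and $m$ the verifier's memory excluding the certificate, as worst-case functions of $n$. *)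

(* Defs.v *)
From mathcomp Require Import all_boot.

Set Implicit Arguments.
Unset Strict Implicit.
Unset Printing Implicit Defensive.

(* A finite simple graph on {0, .., n-1}, given by its set of edges, an edge
   being an unordered pair of distinct vertices. *)
Record sgraph (n : nat) := SGraph {
  edges : {set {set 'I_n}};
  edges_card2 : [forall e in edges, #|e| == 2]
}.

(* Irreflexive because [set u; u] is a singleton, hence never an edge. *)
Definition adj n (G : sgraph n) : rel 'I_n := fun u v => [set u; v] \in edges G.

Definition has_walk n (G : sgraph n) (u v : 'I_n) (k : nat) : bool :=
  [exists p : k.-tuple 'I_n, path (adj G) u p && (last u p == v)].

Lemma connect_has_walk n (G : sgraph n) (u v : 'I_n) :
  connect (adj G) u v -> exists k, has_walk G u v k.
Proof.
case/connectP=> p Gp ->; exists (size p).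
by apply/existsP; exists (in_tuple p); rewrite Gp eqxx.
Qed.

(* Distances and diameters are values of option nat, None standing for
   infinity. *)
Definition dist n (G : sgraph n) (u v : 'I_n) : option nat :=
  match @idP (connect (adj G) u v) with
  | ReflectT uv => Some (ex_minn (connect_has_walk uv))
  | ReflectF _ => None
  end.

Definition emax (a b : option nat) : option nat :=
  if a is Some x then if b is Some y then Some (maxn x y) else None else None.

Definition ege (a : option nat) (k : nat) : bool :=
  if a is Some x then k <= x else true.

Definition diameter n (G : sgraph n) : option nat :=
  \big[emax/Some 0]_(u : 'I_n) \big[emax/Some 0]_(v : 'I_n) dist G u v.

Definition decision_problem := forall n : nat, sgraph n -> bool.

Definition Diameter_ge (k : nat) : decision_problem :=
  fun n G => ege (diameter G) k.

Definition edge_order n (G : sgraph n) (s : seq {set 'I_n}) : bool :=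
  perm_eq s (enum (edges G)).

(* A deterministic streaming algorithm on n-node graphs with m bits of memory.
   The certificate is an extra argument of every operation (read-only access)
   and is not part of the memory. The algorithm is non-uniform in n, and only
   what is stored between two items of the stream is counted as memory. *)
Record verifier (n m : nat) := Verifier {
  vinit : seq bool -> m.-tuple bool;
  vstep : seq bool -> m.-tuple bool -> {set 'I_n} -> m.-tuple bool;
  voutput : seq bool -> m.-tuple bool -> bool
}.

Definition accepts n m (V : verifier n m) (w : seq bool)
    (s : seq {set 'I_n}) : bool :=
  voutput V w (foldl (vstep V w) (vinit V w) s).

(* On n-node graphs, the verifier has m n bits of memory and the certificates
   assigned to yes-instances have at most c n bits; soundness is required
   against certificates of every length. *)
Record certification_scheme (P : decision_problem) (c m : nat -> nat) :=
  CertificationScheme {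
    prover : forall n, sgraph n -> seq bool;
    streaming_verifier : forall n, verifier n (m n);
    certificate_size : forall n (G : sgraph n),
      P n G -> size (prover G) <= c n;
    completeness : forall n (G : sgraph n), P n G ->
      forall s, edge_order G s ->
      accepts (streaming_verifier n) (prover G) s;
    soundness : forall n (G : sgraph n), ~~ P n G ->
      forall w s, edge_order G s ->
      ~~ accepts (streaming_verifier n) w s
  }.

Definition bigOmega (f g : nat -> nat) : Prop :=
  exists K n0 : nat, 0 < K /\ forall n, n0 <= n -> g n <= K * f n.

(* Main.v *)
(* A fooling-set argument. For bit vectors x, y of length N, take vertices
   v_1, ..., v_N and poles a_0, a_1, b_0, b_1; Alice owns the edges v_i a_(x_i),
   Bob owns the edges v_i b_(y_i) and a_b b_b. If x = y, the two sides b = 0 and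
   b = 1 are disconnected, so the diameter is infinite; if x_i <> y_i, then v_i
   is within distance 3 of every vertex, so the diameter is at most 6. Mapping x
   to the certificate of the graph of (x, x) and the memory content after Alice's
   half of the stream is injective: if x and y collided, that certificate would
   make the verifier accept the graph of (x, y). *)
Require Import Defs.
From mathcomp Require Import all_boot.

Set Implicit Arguments.
Unset Strict Implicit.
Unset Printing Implicit Defensive.

(** * Diameter bounds from disconnection and from walks *)

Lemma ege_emax k a b : ege (emax a b) k = ege a k || ege b k.
Proof. by case: a b => [a|] [b|] //=; rewrite ?leq_max ?orbT. Qed.

Lemma Diameter_geE k n (G : sgraph n) : 0 < k ->
  Diameter_ge k G = [exists u, exists v, ege (dist G u v) k].
Proof.
(* The neutral element [Some 0] of the maximum must be sent to [false], the unit of [||]; this is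
   where [0 < k] enters. *)
move=> k_gt0; have ege0 : ege (Some 0) k = false by apply/negbTE; rewrite -ltnNge.
have big_ege (F : 'I_n -> option nat) :
    ege (\big[emax/Some 0]_u F u) k = [exists u, ege (F u) k].
  by rewrite (big_morph (ege^~ k) (ege_emax k) ege0) big_orE.
by rewrite /Diameter_ge big_ege; apply: eq_existsb => u; rewrite big_ege.
Qed.

Lemma ege_dist_disconnected k n (G : sgraph n) u v :
  ~~ connect (adj G) u v -> ege (dist G u v) k.
Proof. by rewrite /dist; case: {-}_ / idP => // uv /negP[]. Qed.

(** Upper bounds witnessed by walks simply add up under concatenation, so the minimum inside [dist]
    is handled only once, in [ege_dist_within]. *)
Definition within n (G : sgraph n) k u v :=
  exists p, [/\ path (adj G) u p, last u p = v & size p <= k].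

Lemma adj_sym n (G : sgraph n) : symmetric (adj G).
Proof. by move=> u v; rewrite /adj setUC. Qed.

Lemma within_sym n (G : sgraph n) k u v : within G k u v -> within G k v u.
Proof.
case=> p [Gp <- szp]; exists (rev (belast u p)).
split; last by rewrite size_rev size_belast.
  by rewrite rev_path; under eq_path do rewrite adj_sym.
by case: p {Gp szp} => //= a p; rewrite rev_cons last_rcons.
Qed.

Lemma within_trans n (G : sgraph n) j k v u w :
  within G j u v -> within G k v w -> within G (j + k) u w.
Proof.
case=> p [Gp <- szp] [q [Gq <- szq]]; exists (p ++ q).
by rewrite cat_path Gp Gq last_cat size_cat leq_add.
Qed.

Lemma within_adj n (G : sgraph n) u v : adj G u v -> within G 1 u v.
Proof. by move=> uv; exists [:: v]; rewrite /= uv. Qed.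

Lemma within_leq n (G : sgraph n) j k u v :
  j <= k -> within G j u v -> within G k u v.
Proof. by move=> jk [p [Gp eq_v szp]]; exists p; rewrite (leq_trans szp). Qed.

Lemma ege_dist_within j k n (G : sgraph n) u v :
  j < k -> within G j u v -> ~~ ege (dist G u v) k.
Proof.
move=> jk [p [Gp eq_v szp]]; rewrite /dist; case: {-}_ / idP => [uv|[]].
  rewrite /= -ltnNge; case: ex_minnP => d _ /(_ (size p)) dp.
  apply: leq_ltn_trans (leq_ltn_trans szp jk); apply: dp.
  by apply/existsP; exists (in_tuple p); rewrite Gp eq_v eqxx.
by apply/connectP; exists p.
Qed.

Lemma Diameter_ge_disconnected k n (G : sgraph n) u v :
  0 < k -> ~~ connect (adj G) u v -> Diameter_ge k G.
Proof.
move=> k_gt0 Nuv; rewrite Diameter_geE //.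
by apply/existsP; exists u; apply/existsP; exists v; apply: ege_dist_disconnected.
Qed.

(** Any two vertices are joined by a walk through the centre [v], of length at most [r + r]. *)
Lemma Diameter_lt_radius r k n (G : sgraph n) v :
  r + r < k -> (forall u, within G r u v) -> ~~ Diameter_ge k G.
Proof.
move=> rk Gr; rewrite Diameter_geE; last exact: leq_ltn_trans rk.
apply/existsPn => u; apply/existsPn => w; apply: ege_dist_within rk _.
exact: within_trans (Gr u) (within_sym (Gr w)).
Qed.

(** * Counting certificates and memory states *)

Lemma card_bseq_bool c : #|{bseq c of bool}| < 2 ^ c.+1.
Proof.
(* Certificates may be shorter than [c], so the count is the geometric sum 1 + 2 + ... + 2^c =
   2^(c+1) - 1. *)
have := predn_exp 2 c.+1; rewrite mul1n card_bseq card_bool => <-.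
by rewrite prednK ?expn_gt0.
Qed.

Lemma streaming_fooling_set (P : decision_problem) (c m : nat -> nat)
    (S : certification_scheme P c m) n (T : finType)
    (A B : T -> seq {set 'I_n}) (G : T -> T -> sgraph n) :
    (forall x y, edge_order (G x y) (A x ++ B y)) ->
    (forall x, P n (G x x)) ->
    (forall x y, x != y -> ~~ P n (G x y)) ->
  #|T| < 2 ^ (c n + m n).+1.
Proof.
move=> GE Gyes Gno; set V := streaming_verifier S n.
pose cert x := prover S (G x x).
pose state x := foldl (vstep V (cert x)) (vinit V (cert x)) (A x).
pose f x : {bseq c n of bool} * (m n).-tuple bool :=
  (Bseq (certificate_size S (Gyes x)), state x).
have f_inj : injective f.
  move=> x y [eq_cert eq_state]; apply/eqP; apply: contraT => neq_xy.
  (* With the certificate of [y], the runs on [G x y] and [G y y] share their memory after the first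
     half and then both read [B y], so acceptance carries over to a no-instance. *)
  have /negP[] := soundness S (Gno x y neq_xy) (cert x) (GE x y).
  have := completeness S (Gyes y) (GE y y).
  rewrite /accepts !foldl_cat -/V -/(cert y) -/(state x) -/(state y) eq_state.
  by rewrite [cert x]eq_cert.
apply: leq_ltn_trans (leq_card f f_inj) _.
rewrite card_prod [X in _ * X]card_tuple card_bool -addSn expnD.
by rewrite ltn_mul2r expn_gt0 card_bseq_bool.
Qed.

(** * The gadget graph *)

Section Gadget.

Variable N : nat.

(** The poles a_0, a_1, b_0, b_1 are numbered 0, 1, 2, 3 in this order, so the subscript of a pole
    is its parity. *)
Definition mid (i : 'I_N) : 'I_(4 + N) := rshift 4 i.
Definition poleA (b : bool) : 'I_(4 + N) := lshift N (inord b).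
Definition poleB (b : bool) : 'I_(4 + N) := lshift N (inord (2 + b)).

Lemma mid_neq_poleA i b : mid i != poleA b.
Proof. by rewrite eq_rlshift. Qed.

Lemma mid_neq_poleB i b : mid i != poleB b.
Proof. by rewrite eq_rlshift. Qed.

Lemma poleA_neq_poleB a b : poleA a != poleB b.
Proof.
by rewrite eq_lshift -val_eqE /= !inordK; case: a b => [] [].
Qed.

Definition edgesA (x : 'I_N -> bool) : {set {set 'I_(4 + N)}} :=
  [set [set mid i; poleA (x i)] | i : 'I_N].

Definition edgesB (y : 'I_N -> bool) : {set {set 'I_(4 + N)}} :=
  [set [set mid i; poleB (y i)] | i : 'I_N]
    :|: [set [set poleA b; poleB b] | b : bool].

Lemma gadget_card2 x y : [forall e in edgesA x :|: edgesB y, #|e| == 2].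
Proof.
apply/forall_inP => e /setUP[/imsetP[i _ ->]|/setUP[]/imsetP[i _ ->]];
  by rewrite cards2 ?mid_neq_poleA ?mid_neq_poleB ?poleA_neq_poleB.
Qed.

Definition gadget x y : sgraph (4 + N) := SGraph (gadget_card2 x y).

(** Each of Bob's edges contains a b-pole and none of Alice's does. Hence the concatenated stream
    lists no edge twice. *)
Lemma edges_disjoint x y e : e \in edgesA x -> e \notin edgesB y.
Proof.
case/imsetP=> i _ ->.
have noB b : poleB b \notin [set mid i; poleA (x i)].
  rewrite !inE negb_or eq_sym mid_neq_poleB.
  by rewrite eq_sym poleA_neq_poleB.
apply/negP => /setUP[]/imsetP[j _ eq_e].
  by have /negP[] := noB (y j); rewrite eq_e !inE eqxx orbT.
by have /negP[] := noB j; rewrite eq_e !inE eqxx orbT.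
Qed.

Lemma gadget_order x y :
  edge_order (gadget x y) (enum (edgesA x) ++ enum (edgesB y)).
Proof.
apply: uniq_perm; rewrite ?enum_uniq //.
  rewrite cat_uniq !enum_uniq andbT /=; apply/hasPn => e.
  rewrite mem_enum => e_B; apply/negP; rewrite /= mem_enum.
  by move/(@edges_disjoint x y); rewrite e_B.
by move=> e; rewrite mem_cat !mem_enum -in_setU.
Qed.

Definition side (x : 'I_N -> bool) (v : 'I_(4 + N)) : bool :=
  match split v with inl p => odd p | inr i => x i end.

Lemma side_mid x i : side x (mid i) = x i.
Proof. by rewrite /side (unsplitK (inr i)). Qed.

Lemma side_poleA x b : side x (poleA b) = b.
Proof. by rewrite /side (unsplitK (inl _)) inordK; case: b. Qed.

Lemma side_poleB x b : side x (poleB b) = b.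
Proof. by rewrite /side (unsplitK (inl _)) inordK; case: b. Qed.

Lemma gadget_side x u v : adj (gadget x x) u v -> side x u = side x v.
Proof.
(* Edges are unordered, so [u] and [v] may match the two named endpoints in either order. *)
have mono a b : side x a = side x b -> [set u; v] = [set a; b] ->
    side x u = side x v.
  move=> eq_ab eq_e; have := set22 u v; have := set21 u v.
  by rewrite eq_e => /set2P[] -> /set2P[] ->.
case/setUP => [/imsetP[i _]|/setUP[]/imsetP[i _]]; apply: mono;
  by rewrite ?side_mid ?side_poleA ?side_poleB.
Qed.

(** [side x] is constant along edges, hence on connected components, yet it tells the two a-poles
    apart. *)
Lemma gadget_disconnected x :
  ~~ connect (adj (gadget x x)) (poleA true) (poleA false).
Proof.
apply/negP => /(@closed_connect _ _ (side x)) eq_side.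
have /eq_side : closed (adj (gadget x x)) (side x).
  by move=> u v /gadget_side; rewrite -!topredE.
by rewrite -!topredE /= !side_poleA.
Qed.

Lemma gadget_adjA x y i : adj (gadget x y) (mid i) (poleA (x i)).
Proof. by rewrite /adj inE; apply/orP; left; apply: imset_f. Qed.

Lemma gadget_adjB x y i : adj (gadget x y) (mid i) (poleB (y i)).
Proof. by rewrite /adj !inE; apply/or3P; apply: Or32; apply: imset_f. Qed.

Lemma gadget_adjAB x y b : adj (gadget x y) (poleA b) (poleB b).
Proof. by rewrite /adj !inE; apply/or3P; apply: Or33; apply: imset_f. Qed.

Lemma gadget_vertex v :
  [\/ exists i, v = mid i, exists b, v = poleA b | exists b, v = poleB b].
Proof.
case: (split_ordP v) => [p ->|i ->]; last by apply: Or31; exists i.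
have lt_p := ltn_ord p; case: (ltnP p 2) => [p2|p2].
  apply: Or32; exists (p == 1 :> nat); congr lshift; apply: val_inj.
  by rewrite /= inordK; case: (nat_of_ord p) p2 => [|[|]].
apply: Or33; exists (p == 3 :> nat); congr lshift; apply: val_inj.
by rewrite /= inordK; case: (nat_of_ord p) p2 lt_p => [|[|[|[|]]]].
Qed.

Lemma gadget_radius x y i v : x i != y i -> within (gadget x y) 3 v (mid i).
Proof.
move=> neq_xy; set G := gadget x y.
have adjw u w : adj G u w -> within G 1 w u.
  by move=> uw; apply: within_sym; apply: within_adj.
(* The pole a_(x_i) is a neighbour of v_i; the other a-pole is a_(y_i), since the two bits differ,
   and it reaches v_i through b_(y_i). Every vertex that is not an a-pole has an a-pole as
   neighbour, which gives 3. *)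
have poleA2 b : within G 2 (poleA b) (mid i).
  have [->|neq_b] := eqVneq b (x i).
    by apply: within_leq (adjw _ _ (gadget_adjA x y i)).
  have -> : b = y i by move: neq_b neq_xy; case: b (x i) (y i) => [] [] [].
  apply: (@within_trans _ _ 1 1 (poleB (y i))).
    exact: within_adj (gadget_adjAB x y _).
  exact: adjw (gadget_adjB x y i).
have [[j ->]|[b ->]|[b ->]] := gadget_vertex v.
- exact: (@within_trans _ _ 1 2 _ _ _ (within_adj (gadget_adjA x y j))).
- exact: within_leq (poleA2 b).
- exact: (@within_trans _ _ 1 2 _ _ _ (adjw _ _ (gadget_adjAB x y b))).
Qed.

End Gadget.

Theorem theorem13 (c m : nat -> nat)
    (S : certification_scheme (Diameter_ge 8) c m) :
  bigOmega (fun n : nat => c n + m n) (fun n : nat => n).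
Proof.
(* Write n = 4 + N. The fooling set has 2^N elements, so N <= c + m; and 4 + N <= 5 * N as soon as N
   > 0, that is n >= 5. *)
exists 5, 5; split=> // n n_ge5; have n_ge4 := ltnW n_ge5.
rewrite -(subnKC n_ge4) in n_ge5 *; move: (n - 4) n_ge5 => N N_gt0 {n n_ge4}.
have fooling := @streaming_fooling_set _ c m S (4 + N) {ffun 'I_N -> bool}
  (fun x => enum (edgesA x)) (fun y => enum (edgesB y))
  (fun x y => gadget x y) (fun x y => gadget_order x y).
have : #|{ffun 'I_N -> bool}| < 2 ^ (c (4 + N) + m (4 + N)).+1.
  apply: fooling => [x|x y neq_xy].
    exact: Diameter_ge_disconnected (gadget_disconnected x).
  have [i neq_i] : exists i, x i != y i.
    apply/existsP; apply: contraNT neq_xy => /existsPn eq_xy.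
    by apply/eqP/ffunP => i; apply/eqP; have := eq_xy i; rewrite negbK.
  by apply: (@Diameter_lt_radius 3 8 _ _ (mid i)) => // v; apply: gadget_radius.
rewrite card_ffun card_bool card_ord ltn_exp2l // ltnS => N_le.
apply: leq_trans (leq_mul (leqnn 5) N_le).
by rewrite (mulnDl 4 1) mul1n leq_add2r leq_pmulr.
Qed.
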